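(* Suppose that a cubic Kolmogorov vector field on $\mathbb{T}^2$ has finitely many invariant meridians and finitely many invariant parallels. Then $x=0$ and $y=0$ are the only invariant meridian planes and $z=0$ is the only invariant parallel plane.
   Context: Fix a real number $a>1$ and let $\mathbb{T}^2=\{(x,y,z)\in\mathbb{R}^3:(x^2+y^2-a^2)^2+z^2-1=0\}$. A triple $\chi=(P,Q,R)$ with $P,Q,R\in\mathbb{R}[x,y,z]$ denotes the polynomial vector field $P\frac{\partial}{\partial x}+Q\frac{\partial}{\partial y}+R\frac{\partial}{\partial z}$ in $\mathbb{R}^3$, acting on polynomials as a derivation; its degree is $\max\{\deg P,\deg Q,\deg R\}$, and it is cubic if its degree is $3$. It is a Kolmogorov vector field if $x\mid P$, $y\mid Q$, $z\mid R$. An algebraic surface $\{g=0\}$ is invariant for $\chi$ if $\chi g=Lg$ for some $L\in\mathbb{R}[x,y,z]$; $\chi$ is a vector field on $\mathbb{T}^2$ if $\{(x^2+y^2-a^2)^2+z^2-1=0\}$ is invariant in this sense. A meridian plane is a plane $\{\lambda x+\mu y=0\}$ with $(\lambda,\mu)\in\mathbb{R}^2\setminus\{(0,0)\}$, and the curves in its intersection with $\mathbb{T}^2$ are meridians. A parallel plane is a plane $\{z-k=0\}$ with $-1\leq k\leq 1$, and the curves in its intersection with $\mathbb{T}^2$ are parallels. A meridian (parallel) is invariant if its meridian (parallel) plane is invariant for $\chi$. *)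

(* Defs.v *)
From mathcomp Require Import all_boot all_order all_algebra.
From mathcomp Require Import mpoly.
From mathcomp Require Import classical_sets cardinality reals.
From mathcomp Require Import topology num_topology matrix_topology.
Set Implicit Arguments.
Unset Strict Implicit.
Unset Printing Implicit Defensive.
Import GRing.Theory Num.Theory.
Import numFieldTopology.Exports.
Local Open Scope classical_set_scope.
Local Open Scope ring_scope.

Section TorusVectorFields.
Variable R : realType.

Definition poly3 := {mpoly R[3]}.

Definition ix : 'I_3 := @Ordinal 3 0 isT.
Definition iy : 'I_3 := @Ordinal 3 1 isT.
Definition iz : 'I_3 := @Ordinal 3 2 isT.
Definition X : poly3 := 'X_ix.
Definition Y : poly3 := 'X_iy.
Definition Z : poly3 := 'X_iz.

(* The field P d/dx + Q d/dy + R d/dz has components P, Q, R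
   at the indices ix, iy, iz. *)
Definition vfield := 'I_3 -> poly3.

Definition vf_apply (chi : vfield) (g : poly3) : poly3 :=
  \sum_(i < 3) chi i * g^`M(i).

(* msize p is the total degree plus one (and msize 0 = 0), so the zero
   polynomial has degree 0 here. *)
Definition vf_degree (chi : vfield) : nat :=
  \max_(i < 3) (msize (chi i)).-1.

Definition cubic (chi : vfield) : Prop := vf_degree chi = 3%N.

Definition mdvd (p q : poly3) : Prop := exists r : poly3, q = p * r.

Definition kolmogorov (chi : vfield) : Prop :=
  [/\ mdvd X (chi ix), mdvd Y (chi iy) & mdvd Z (chi iz)].

Definition invariant_surface (chi : vfield) (g : poly3) : Prop :=
  exists L : poly3, vf_apply chi g = L * g.

Definition zero_locus (g : poly3) : set 'rV[R]_3 :=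
  [set v | g.@[fun i => v ord0 i] = 0].

Definition torus_poly (a : R) : poly3 :=
  (X ^+ 2 + Y ^+ 2 - (a ^+ 2)%:MP) ^+ 2 + Z ^+ 2 - 1.

Definition torus (a : R) : set 'rV[R]_3 := zero_locus (torus_poly a).

Definition vfield_on_torus (a : R) (chi : vfield) : Prop :=
  invariant_surface chi (torus_poly a).

(* Linear forms cutting out the meridian planes, resp. the parallel planes. *)
Definition meridian_form (g : poly3) : Prop :=
  exists l m : R, (l, m) <> (0, 0) /\ g = l *: X + m *: Y.

Definition parallel_form (g : poly3) : Prop :=
  exists k : R, -1 <= k <= 1 /\ g = Z - k%:MP.

Definition invariant_meridian_planes (chi : vfield) : set (set 'rV[R]_3) :=
  [set zero_locus g | g in
     [set g | meridian_form g /\ invariant_surface chi g]].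

Definition invariant_parallel_planes (chi : vfield) : set (set 'rV[R]_3) :=
  [set zero_locus g | g in
     [set g | parallel_form g /\ invariant_surface chi g]].

(* The curves making up a plane section of the torus are the connected
   components of this section (two disjoint closed curves, or a single one for
   the extreme parallel planes z = 1 and z = -1). *)
Definition curves_in (a : R) (H : set 'rV[R]_3) : set (set 'rV[R]_3) :=
  [set connected_component (H `&` torus a) v | v in H `&` torus a].

Definition invariant_meridians (a : R) (chi : vfield) : set (set 'rV[R]_3) :=
  \bigcup_(H in invariant_meridian_planes chi) curves_in a H.

Definition invariant_parallels (a : R) (chi : vfield) : set (set 'rV[R]_3) :=
  \bigcup_(H in invariant_parallel_planes chi) curves_in a H.

End TorusVectorFields.

(* Main.v *)
Require Import Defs.
From mathcomp Require Import all_boot all_order all_algebra.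
From mathcomp Require Import classical_sets cardinality reals.
From mathcomp Require Import mpoly ring lra zify.
From mathcomp Require Import topology num_topology matrix_topology.
Set Implicit Arguments.
Unset Strict Implicit.
Unset Printing Implicit Defensive.
Import Order.TTheory GRing.Theory Num.Theory.
Import numFieldTopology.Exports.
Local Open Scope classical_set_scope.
Local Open Scope ring_scope.

(* Write P = xA, Q = yB, R = zC and s = x^2 + y^2 - a^2. Tangency to the torus
   reads 4 s (x^2 A + y^2 B) + 2 z^2 C = L (s^2 + z^2 - 1) with L of degree at
   most 2. Comparing coefficients gives L = 4 l z^2, as a^4 <> 1; subtracting
   the solution A = B = l z^2, C = 2 l (z^2 - 1 - a^2 s) leaves a syzygy whose
   only solutions are A = d y^2, B = - d x^2, C = 0. Hence
     P = x (l z^2 + d y^2),  Q = y (l z^2 - d x^2),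
     R = 2 l z (z^2 - a^2 (x^2 + y^2) + a^4 - 1).
   If l = 0 every parallel is invariant, and if d = 0 every meridian is; so
   both are nonzero, and evaluating the cofactor equation of a plane at points
   of that plane leaves only the coordinate planes. *)

(** * Coefficients and degree bounds in three variables *)

Section Coefficients.
Variable R : realType.
Implicit Types p q : poly3 R.
Local Notation X := (X R).
Local Notation Y := (Y R).
Local Notation Z := (Z R).

(** Explicit exponents let concrete coefficients of an equation be extracted by shifting indices. *)
Definition mon3 (i j k : nat) : 'X_{1..3} := [multinom [tuple i; j; k]].
Definition cf p i j k : R := p@_(mon3 i j k).
Arguments cf p (i j k)%_N.

Lemma mon3E (m : 'X_{1..3}) : m = mon3 (m ix) (m iy) (m iz).
Proof.
apply/mnmP => -[[|[|[|//]]] hi]; rewrite [RHS]multinomE /tnth /=;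
  by congr (m _); apply: val_inj.
Qed.

Lemma mdeg_mon3 i j k : mdeg (mon3 i j k) = (i + j + k)%N.
Proof. by rewrite mdegE !big_ord_recl big_ord0 !multinomE /tnth /= addn0 addnA. Qed.

Lemma poly3P p q : (forall i j k, cf p i j k = cf q i j k) -> p = q.
Proof. by move=> h; apply/mpolyP => m; rewrite (mon3E m); exact: h. Qed.

Lemma mon3S1 i j k : mon3 i.+1 j k = (U_(ix) + mon3 i j k)%MM.
Proof.
by apply/mnmP => -[[|[|[|//]]] hi]; rewrite mnmDE mnm1E !multinomE /tnth.
Qed.

Lemma mon3S2 i j k : mon3 i j.+1 k = (U_(iy) + mon3 i j k)%MM.
Proof.
by apply/mnmP => -[[|[|[|//]]] hi]; rewrite mnmDE mnm1E !multinomE /tnth.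
Qed.

Lemma mon3S3 i j k : mon3 i j k.+1 = (U_(iz) + mon3 i j k)%MM.
Proof.
by apply/mnmP => -[[|[|[|//]]] hi]; rewrite mnmDE mnm1E !multinomE /tnth.
Qed.

Lemma mcoeff_MXU0 (i : 'I_3) p (m : 'X_{1..3}) : m i = 0%N -> ('X_i * p)@_m = 0.
Proof.
move=> mi0; rewrite mcoeffM big1 // => -[m1 m2] /= /eqP mE.
rewrite mcoeffX; case: eqP => [m1E|]; last by rewrite mul0r.
by move/(congr1 (fun m0 : 'X_{1..3} => m0 i)): mE; rewrite mi0 mnmDE -m1E mnm1E eqxx.
Qed.

Lemma cfXS p i j k : cf (X * p) i.+1 j k = cf p i j k.
Proof. by rewrite /cf mon3S1 mulrC mcoeffMX. Qed.
Lemma cfYS p i j k : cf (Y * p) i j.+1 k = cf p i j k.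
Proof. by rewrite /cf mon3S2 mulrC mcoeffMX. Qed.
Lemma cfZS p i j k : cf (Z * p) i j k.+1 = cf p i j k.
Proof. by rewrite /cf mon3S3 mulrC mcoeffMX. Qed.
Lemma cfX0 p j k : cf (X * p) 0 j k = 0.
Proof. by apply: mcoeff_MXU0; rewrite multinomE. Qed.
Lemma cfY0 p i k : cf (Y * p) i 0 k = 0.
Proof. by apply: mcoeff_MXU0; rewrite multinomE. Qed.
Lemma cfZ0 p i j : cf (Z * p) i j 0 = 0.
Proof. by apply: mcoeff_MXU0; rewrite multinomE. Qed.
Lemma cfD p q i j k : cf (p + q) i j k = cf p i j k + cf q i j k.
Proof. exact: mcoeffD. Qed.
Lemma cfN p i j k : cf (- p) i j k = - cf p i j k.
Proof. exact: mcoeffN. Qed.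
Lemma cfCM c p i j k : cf (c%:MP * p) i j k = c * cf p i j k.
Proof. exact: mcoeffCM. Qed.
Lemma cf0 i j k : cf 0 i j k = 0.
Proof. exact: mcoeff0. Qed.
Lemma cf1 i j k : cf 1 i j k = ((i + j + k)%N == 0%N)%:R.
Proof. by rewrite /cf mcoeff1 -mdeg_mon3 mdeg_eq0. Qed.

Lemma cf_gt p n i j k : (msize p <= n)%N -> (n <= i + j + k)%N -> cf p i j k = 0.
Proof.
move=> hp hn; apply/eqP; rewrite /cf mcoeff_eq0; apply: msize_mdeg_ge.
by rewrite mdeg_mon3; apply: leq_trans hn.
Qed.

Lemma msize_cf p n :
  (forall i j k, (n <= i + j + k)%N -> cf p i j k = 0) -> (msize p <= n)%N.
Proof.
move=> h; rewrite msizeE; apply/bigmax_leqP_seq => m + _.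
rewrite mcoeff_msupp ltnNge; apply: contra => hm.
by rewrite (mon3E m); apply/eqP/h; rewrite -mdeg_mon3 -mon3E.
Qed.

Lemma msizeMX_le p n (i : 'I_3) : (msize ('X_i * p) <= n.+1)%N -> (msize p <= n)%N.
Proof.
move=> h; apply: msize_cf => i1 j k hn; rewrite /cf -(mcoeffMX _ U_(i)) mulrC.
apply/eqP; rewrite mcoeff_eq0; apply: msize_mdeg_ge.
by rewrite mdegD mdeg1 mdeg_mon3 (leq_trans h).
Qed.

Lemma mderivXU (i j : 'I_3) : ('X_j : poly3 R)^`M(i) = (i == j)%:R.
Proof.
rewrite mderivX mnm1E eq_sym; case: eqP => [->|_]; last by rewrite scale0r.
rewrite (_ : (_ - _)%MM = 0%MM) ?mpolyX0 ?scale1r //; apply/mnmP => k; rewrite mnmBE mnm0E subnn //.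
Qed.

Lemma mpolyC_exp (c : R) n : (c ^+ n)%:MP = c%:MP ^+ n :> poly3 R.
Proof. by elim: n => [|n IHn]; rewrite ?expr0 ?mpolyC1// !exprS mpolyCM IHn. Qed.

(** Distributes the embedding of constants over the ring operations, so that [ring] can compare
    constant coefficients. *)
Definition mpolyCE := (mpolyC_exp, mpolyCB, mpolyCN, mpolyCM, mpolyCD, mpolyC_nat, mpolyC1).

(** The trailing factors [1] give every term the shape of a variable or constant times a polynomial,
    so that the coefficient rules apply down to the end. *)
Lemma torus_polyE a : torus_poly a =
  X * (X * (X * (X * 1))) + Y * (Y * (Y * (Y * 1))) + 2%:MP * (X * (X * (Y * (Y * 1))))
  - (2 * a ^+ 2)%:MP * (X * (X * 1)) - (2 * a ^+ 2)%:MP * (Y * (Y * 1))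
  + Z * (Z * 1) + (a ^+ 4 - 1)%:MP * 1.
Proof.
rewrite /torus_poly !mpolyCE. ring.
Qed.

Lemma vf_apply3 (chi : vfield R) g : vf_apply chi g =
  chi ix * g^`M(ix) + chi iy * g^`M(iy) + chi iz * g^`M(iz).
Proof.
rewrite /vf_apply !big_ord_recl big_ord0 addr0 addrA.
by congr (_ * _^`M(_) + _ * _^`M(_) + _ * _^`M(_)); try congr (chi _); apply: val_inj.
Qed.

Lemma vf_apply_torus a (chi : vfield R) : vf_apply chi (torus_poly a) =
  4%:MP * (X ^+ 2 + Y ^+ 2 - (a ^+ 2)%:MP) * (X * chi ix + Y * chi iy)
  + 2%:MP * Z * chi iz.
Proof.
rewrite vf_apply3 /torus_poly !expr2.
rewrite !(mderivB, mderivD, mderivM, mderivC, mderivXU) /=.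
rewrite !mpolyCE. ring.
Qed.

Lemma msizeD_leq p q n : (msize p <= n)%N -> (msize q <= n)%N -> (msize (p + q) <= n)%N.
Proof.
by move=> hp hq; apply: msize_cf => i j k h; rewrite cfD !(@cf_gt _ n) ?addr0.
Qed.

Lemma msizeCM_leq c p n : (msize p <= n)%N -> (msize (c%:MP * p) <= n)%N.
Proof.
by move=> hp; apply: msize_cf => i j k h; rewrite cfCM (@cf_gt _ n) ?mulr0.
Qed.

Lemma msizeMX_leq p n (i : 'I_3) : (msize p <= n)%N -> (msize ('X_i * p) <= n.+1)%N.
Proof.
have [->|p0] := eqVneq p 0; first by rewrite mulr0 msize0.
have X0 : 'X_i != 0 :> poly3 R by rewrite -msize_poly_eq0 msizeX.
have hM : msize ('X_i * p) = (msize ('X_i : poly3 R) + msize p).-1 := msizeM X0 p0.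
by rewrite hM msizeX mdeg1.
Qed.

End Coefficients.
Arguments cf {R} p (i j k)%_N.

(* Polynomials are written as sums of nested products [X * (X * p)] so that one
   rule per variable shifts the index. Matching is
   syntactic because keyed unification would unfold the polynomial operations;
   [cf] is made opaque for the same reason. *)
Ltac cf_simp := repeat match goal with
  | |- context [cf (?p + ?q) ?i ?j ?k] => rewrite (cfD p q i j k)
  | |- context [cf (- ?p) ?i ?j ?k] => rewrite (cfN p i j k)
  | |- context [cf (?c%:MP * ?p) ?i ?j ?k] => rewrite (cfCM c p i j k)
  | |- context [cf (Defs.X _ * ?p) ?i.+1 ?j ?k] => rewrite (cfXS p i j k)
  | |- context [cf (Defs.X _ * ?p) 0 ?j ?k] => rewrite (cfX0 p j k)
  | |- context [cf (Defs.Y _ * ?p) ?i ?j.+1 ?k] => rewrite (cfYS p i j k)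
  | |- context [cf (Defs.Y _ * ?p) ?i 0 ?k] => rewrite (cfY0 p i k)
  | |- context [cf (Defs.Z _ * ?p) ?i ?j ?k.+1] => rewrite (cfZS p i j k)
  | |- context [cf (Defs.Z _ * ?p) ?i ?j 0] => rewrite (cfZ0 p i j)
  | |- context [cf (@GRing.one _) ?i ?j ?k] => rewrite (@cf1 _ i j k)
  | |- context [cf (@Algebra.zero _) ?i ?j ?k] => rewrite (@cf0 _ i j k)
  end.

Ltac cf_simplify :=
  cf_simp; rewrite ?(mulr0, add0r, addr0, oppr0).

#[global] Opaque cf mon3.

(* The three equations are the coefficients of x^6, x^4 and x^2 in the tangency
   equation, with L2 the coefficient of x^2 in L. *)
Lemma cofactor_square_coef (R : realFieldType) (a A0 A2 L2 : R) :
  4 * A2 = L2 -> 4 * (A0 - a ^+ 2 * A2) = - (2 * a ^+ 2 * L2) ->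
  4 * - (a ^+ 2 * A0) = (a ^+ 4 - 1) * L2 -> L2 = 0.
Proof.
move=> e6 e4 e2; have A2E : A2 = L2 / 4 by lra.
have A0E : A0 = - (a ^+ 2 * L2) / 4 by subst A2; lra.
by subst A0; lra.
Qed.

(** * Solving the tangency equation *)

Section NormalForm.
Variable R : realType.
Implicit Types p q : poly3 R.
Local Notation X := (X R).
Local Notation Y := (Y R).
Local Notation Z := (Z R).

(** Degrees add in an integral domain: applying the field to the torus polynomial, of degree at
    least 4, raises the degree bound of its components by 3 only. *)
Lemma torus_cofactor_degree a (chi : vfield R) L n :
  (forall i, msize (chi i) <= n)%N ->
  vf_apply chi (torus_poly a) = L * torus_poly a -> (msize L <= n.-1)%N.
Proof.
move=> hchi; rewrite vf_apply_torus => hL.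
have [->|L0] := eqVneq L 0; first by rewrite msize0.
have hT : (5 <= msize (torus_poly a))%N.
  rewrite ltnNge; apply/negP => h.
  (* The coefficient of [x^4] in the torus polynomial is 1. *)
  have := cf_gt (i := 4) (j := 0) (k := 0) h isT.
  rewrite torus_polyE; cf_simp; rewrite /= !(mulr0, addr0, subr0) => /eqP.
  by rewrite oner_eq0.
have T0 : torus_poly a != 0 by rewrite -msize_poly_eq0 -lt0n (leq_trans _ hT).
have : (msize (L * torus_poly a) <= n.+3)%N.
  rewrite -hL.
  rewrite (_ : _ + _ = 4%:MP * (X * (X * (X * chi ix + Y * chi iy))) +
    4%:MP * (Y * (Y * (X * chi ix + Y * chi iy))) +
    (- 4 * a ^+ 2)%:MP * (X * chi ix + Y * chi iy) + 2%:MP * (Z * chi iz)).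
    have hW : (msize (X * chi ix + Y * chi iy) <= n.+1)%N.
      by apply: msizeD_leq; apply: msizeMX_leq.
    have hZ : (msize (Z * chi iz) <= n.+3)%N by do 2 apply: leqW; exact: msizeMX_leq.
    do ?[apply: msizeD_leq]; apply: msizeCM_leq => //; last exact/leqW/leqW.
      by do 2 apply: msizeMX_leq.
    by do 2 apply: msizeMX_leq.
  rewrite !mpolyCE; ring.
have hM : msize (L * torus_poly a) = (msize L + msize (torus_poly a)).-1.
  exact: msizeM.
rewrite hM; lia.
Qed.

Lemma poly3_deg2P p q : (msize p <= 3)%N -> (msize q <= 3)%N ->
  (forall i j k, (i + j + k <= 2)%N -> cf p i j k = cf q i j k) -> p = q.
Proof.
move=> hp hq h; apply: poly3P => i j k; case: (leqP (i + j + k) 2) => [|hn]; first exact: h.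
by rewrite (cf_gt hp hn) (cf_gt hq hn).
Qed.

(** On the left, and in every nonconstant term of the torus polynomial, each monomial is divisible
    by a square of a variable. Hence the coefficient of a square-free monomial in [L], times
    [a^4 - 1], is 0. Of the degrees up to 2 only [x^2], [y^2], [z^2] remain, and the first two are
    excluded by [cofactor_square_coef]. *)
Lemma torus_cofactor_multiple_Z2 a A B C L : 1 < a -> (msize L <= 3)%N ->
  (msize A <= 3)%N -> (msize B <= 3)%N -> (msize C <= 3)%N ->
  4%:MP * (X ^+ 2 + Y ^+ 2 - (a ^+ 2)%:MP) * (X * (X * A) + Y * (Y * B))
    + 2%:MP * Z * (Z * C) = L * torus_poly a ->
  exists l, L = l%:MP * (Z * (Z * 1)).
Proof.
move=> a1 hL hA hB hC; rewrite torus_polyE => E.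
have {}E : 4%:MP * (X * (X * (X * (X * A))) + X * (X * (Y * (Y * A)))
      - (a ^+ 2)%:MP * (X * (X * A)) + X * (X * (Y * (Y * B))) + Y * (Y * (Y * (Y * B)))
      - (a ^+ 2)%:MP * (Y * (Y * B))) + 2%:MP * (Z * (Z * C))
   = X * (X * (X * (X * L))) + Y * (Y * (Y * (Y * L))) + 2%:MP * (X * (X * (Y * (Y * L))))
  - (2 * a ^+ 2)%:MP * (X * (X * L)) - (2 * a ^+ 2)%:MP * (Y * (Y * L))
  + Z * (Z * L) + (a ^+ 4 - 1)%:MP * L.
  by apply: etrans (etrans _ E) _; rewrite !mpolyCE; ring.
have {}E i j k := congr1 (fun p => cf p i j k) E.
have a4 : a ^+ 4 - 1 != 0 by rewrite lt0r_neq0 ?subr_gt0 ?exprn_egt1.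
move: (E 0 0 0)%N; cf_simplify => E000.
move: (E 0 0 1)%N; cf_simplify => E001.
move: (E 1 0 0)%N; cf_simplify => E100.
move: (E 0 1 0)%N; cf_simplify => E010.
move: (E 1 0 1)%N; cf_simplify => E101.
move: (E 0 1 1)%N; cf_simplify => E011.
move: (E 1 1 0)%N; cf_simplify => E110.
move: (E 2 0 0)%N; cf_simplify => E200.
move: (E 4 0 0)%N; cf_simplify => E400.
move: (E 6 0 0)%N; cf_simplify => E600.
move: (E 0 2 0)%N; cf_simplify => E020.
move: (E 0 4 0)%N; cf_simplify => E040.
move: (E 0 6 0)%N; cf_simplify => E060.
have z (i j k : nat) p : (msize p <= 3)%N -> (2 < i + j + k)%N -> cf p i j k = 0 by exact: cf_gt.
(* The degree bounds remove the coefficients of degree 4 and 6, which leaves the three equations of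
   [cofactor_square_coef], once in [x] and once in [y]. *)
have [[A4 L4] L6] := (z 4%N 0%N 0%N A hA isT, z 4%N 0%N 0%N L hL isT, z 6%N 0%N 0%N L hL isT).
have [[B4 L4'] L6'] := (z 0%N 4%N 0%N B hB isT, z 0%N 4%N 0%N L hL isT, z 0%N 6%N 0%N L hL isT).
rewrite L4 in E400; rewrite A4 L4 L6 in E600.
rewrite L4' in E040; rewrite B4 L4' L6' in E060.
have L000 : cf L 0 0 0 = 0 by apply: (mulfI a4); rewrite mulr0 -E000.
have L001 : cf L 0 0 1 = 0 by apply: (mulfI a4); rewrite mulr0 -E001.
have L100 : cf L 1 0 0 = 0 by apply: (mulfI a4); rewrite mulr0 -E100.
have L010 : cf L 0 1 0 = 0 by apply: (mulfI a4); rewrite mulr0 -E010.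
have L101 : cf L 1 0 1 = 0 by apply: (mulfI a4); rewrite mulr0 -E101.
have L011 : cf L 0 1 1 = 0 by apply: (mulfI a4); rewrite mulr0 -E011.
have L110 : cf L 1 1 0 = 0 by apply: (mulfI a4); rewrite mulr0 -E110.
rewrite L000 !(mulr0, add0r, addr0, subr0, oppr0) in E200 E020 E400 E040 E600 E060.
have L200 := cofactor_square_coef E600 E400 E200.
have L020 := cofactor_square_coef E060 E040 E020.
exists (cf L 0 0 2); apply: poly3_deg2P => //.
  by apply: msizeCM_leq; rewrite !msizeMX_leq // msize1.
case=> [|[|[|i]]] [|[|[|j]]] [|[|[|k]]] // _; cf_simp; by rewrite /= ?(mulr0, mulr1).
Qed.

(** Low-degree coefficients force [C = 0]. Then [x^2 A = - y^2 B], so [y^2] divides [A] and [x^2]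
    divides [B]; having degree at most 2, both quotients are constants. *)
Lemma sum_squares_syzygy a A B C : a != 0 -> (msize A <= 3)%N -> (msize B <= 3)%N ->
  (msize C <= 3)%N ->
  2%:MP * (X ^+ 2 + Y ^+ 2 - (a ^+ 2)%:MP) * (X * (X * A) + Y * (Y * B)) + Z * (Z * C) = 0 ->
  C = 0 /\ exists d, A = d%:MP * (Y * (Y * 1)) /\ B = (- d)%:MP * (X * (X * 1)).
Proof.
move=> a0 hA hB hC E0.
have z (i j k : nat) p : (msize p <= 3)%N -> (2 < i + j + k)%N -> cf p i j k = 0 by exact: cf_gt.
have C0 : C = 0.
  have E : 2%:MP * (X * (X * (X * (X * A))) + X * (X * (Y * (Y * A)))
      - (a ^+ 2)%:MP * (X * (X * A)) + X * (X * (Y * (Y * B))) + Y * (Y * (Y * (Y * B)))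
      - (a ^+ 2)%:MP * (Y * (Y * B))) + Z * (Z * C) = 0.
    by rewrite -E0 !mpolyCE; ring.
  have {}E i j k := congr1 (fun p => cf p i j k) E.
  (* At [x^4 z^2] only the [z^2] coefficient of [A] survives the degree bounds, so it vanishes; then
     [x^2 z^2] shows that the [x^2] coefficient of [C] vanishes. The same holds for [B] and [y]. All
     other coefficients of [C] stand alone in their equation. *)
  move: (E 2 0 2)%N; cf_simplify => E202; move: (E 4 0 2)%N; cf_simplify => E402.
  move: (E 0 2 2)%N; cf_simplify => E022; move: (E 0 4 2)%N; cf_simplify => E042.
  rewrite !(z 4%N 0%N 0%N C, z 2%N 0%N 2%N A) // ?(mulr0, subr0, addr0) in E402.
  rewrite !(z 0%N 4%N 0%N C, z 0%N 2%N 2%N B) // ?(mulr0, subr0, addr0) in E042.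
  have two0 : 2 != 0 :> R by rewrite pnatr_eq0.
  have A0 : cf A 0 0 2 = 0 by apply: (mulfI two0); rewrite E402 mulr0.
  have B0 : cf B 0 0 2 = 0 by apply: (mulfI two0); rewrite E042 mulr0.
  rewrite A0 !(mulr0, add0r, oppr0) in E202.
  rewrite B0 !(mulr0, add0r, oppr0) in E022.
  apply: poly3_deg2P; rewrite ?msize0 // => i j k hijk.
  move: (E i j k.+2) => {E}; rewrite cf0; move: hijk.
  by case: i => [|[|[|i]]]; case: j => [|[|[|j]]]; case: k => [|[|[|k]]] // _; cf_simplify.
(* The factor [2 (x^2 + y^2 - a^2)] is nonzero and can be cancelled. *)
split=> //; move: E0; rewrite C0 !mulr0 addr0 => /eqP; rewrite mulf_eq0 => /orP[|/eqP E0].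
  have /negP // : 2%:MP * (X ^+ 2 + Y ^+ 2 - (a ^+ 2)%:MP) != 0.
  rewrite (_ : _ * _ = 2%:MP * (X * (X * 1)) + 2%:MP * (Y * (Y * 1)) - (2 * a ^+ 2)%:MP * 1).
    apply/eqP => /(congr1 (fun p => cf p 2 0 0)); cf_simplify.
    by rewrite /= mulr1 => /eqP; rewrite pnatr_eq0.
  by rewrite !mpolyCE; ring.
have {}E i j k := congr1 (fun p => cf p i j k) E0.
exists (cf A 0 2 0); split; apply: poly3_deg2P => //.
- by apply: msizeCM_leq; rewrite !msizeMX_leq // msize1.
- move=> i j k hijk; move: (E i.+2 j k) => {E}; move: hijk.
  by case: i => [|[|[|i]]]; case: j => [|[|[|j]]]; case: k => [|[|[|k]]] // _; cf_simplify;
    rewrite /= ?mulr1.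
- by apply: msizeCM_leq; rewrite !msizeMX_leq // msize1.
- move=> i j k hijk; move: (E 2 2 0)%N (E i j.+2 k) => {E}; move: hijk.
  case: i => [|[|[|i]]]; case: j => [|[|[|j]]]; case: k => [|[|[|k]]] // _; cf_simplify;
    rewrite /= ?mulr1 // => /eqP.
  by rewrite addrC addr_eq0 => /eqP.
Qed.

Lemma cubic_kolmogorov_normal_form a (chi : vfield R) :
  1 < a -> (vf_degree chi <= 3)%N -> kolmogorov chi -> vfield_on_torus a chi ->
  exists l d : R,
  [/\ chi ix = X * (l%:MP * Z ^+ 2 + d%:MP * Y ^+ 2),
      chi iy = Y * (l%:MP * Z ^+ 2 - d%:MP * X ^+ 2) &
      chi iz = Z * ((2 * l)%:MP *
        (Z ^+ 2 - (a ^+ 2)%:MP * (X ^+ 2 + Y ^+ 2) + (a ^+ 4 - 1)%:MP))].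
Proof.
move=> a1 hdeg [[A hA] [B hB] [C hC]] [L hL].
have a0 : a != 0 by rewrite gt_eqF // (lt_trans ltr01).
have hchi i : (msize (chi i) <= 4)%N.
  by move: hdeg => /bigmax_leqP /(_ i isT); case: (msize (chi i)).
have sA : (msize A <= 3)%N by apply: (msizeMX_le (i := ix)); rewrite -[_ * A]hA.
have sB : (msize B <= 3)%N by apply: (msizeMX_le (i := iy)); rewrite -[_ * B]hB.
have sC : (msize C <= 3)%N by apply: (msizeMX_le (i := iz)); rewrite -[_ * C]hC.
have sL := torus_cofactor_degree hchi hL.
move: hL; rewrite vf_apply_torus hA hB hC => hL.
have [l' L_E] := torus_cofactor_multiple_Z2 a1 sL sA sB sC hL.
have [l l'E] : exists l, l' = 4 * l by exists (l' / 4); rewrite mulrC divfK // pnatr_eq0.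
have sM c (i : 'I_3) : (msize (c%:MP * ('X_i * ('X_i * 1)) : poly3 R) <= 3)%N.
  by apply: msizeCM_leq; rewrite !msizeMX_leq // msize1.
have sA' : (msize (A + (- l)%:MP * (Z * (Z * 1))) <= 3)%N by apply: msizeD_leq => //; apply: (sM _ iz).
have sB' : (msize (B + (- l)%:MP * (Z * (Z * 1))) <= 3)%N by apply: msizeD_leq => //; apply: (sM _ iz).
(* [D] is minus the third component [2 l (z^2 - 1 - a^2 s)] of the particular solution. It works
   because [s (x^2 + y^2) + z^2 - 1 - a^2 s = s^2 + z^2 - 1]. *)
pose D := (- (2 * l))%:MP * (Z * (Z * 1)) + (2 * l * a ^+ 2)%:MP * (X * (X * 1))
  + (2 * l * a ^+ 2)%:MP * (Y * (Y * 1)) + (2 * l * (1 - a ^+ 4))%:MP * 1.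
have sC' : (msize (C + D) <= 3)%N.
  do ?[apply: msizeD_leq => //]; [exact: (sM _ iz)|exact: (sM _ ix)|exact: (sM _ iy)|].
  by apply: msizeCM_leq; rewrite msize1.
have [|C'0 [d [A'E B'E]]] := sum_squares_syzygy a0 sA' sB' sC'.
  (* Tangency minus the particular solution is twice the syzygy. *)
  have : 2%:MP * (2%:MP * (X ^+ 2 + Y ^+ 2 - (a ^+ 2)%:MP) *
      (X * (X * (A + (- l)%:MP * (Z * (Z * 1)))) + Y * (Y * (B + (- l)%:MP * (Z * (Z * 1)))))
      + Z * (Z * (C + D))) = 0 :> poly3 R.
    move/eqP: hL; rewrite L_E l'E -subr_eq0 => /eqP; apply: etrans.
    by rewrite /D /torus_poly !mpolyCE; ring.
  by move/eqP; rewrite mulf_eq0 mpolyC_eq0 pnatr_eq0 => /eqP.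
exists l, d; split; congr (_ * _).
- by rewrite -[A](addrK ((- l)%:MP * (Z * (Z * 1)))) A'E !mpolyCE; ring.
- by rewrite -[B](addrK ((- l)%:MP * (Z * (Z * 1)))) B'E !mpolyCE; ring.
- by rewrite -[C](addrK D) C'0 /D !mpolyCE; ring.
Qed.
End NormalForm.

(** * From invariant planes to curves on the torus *)

Section InvariantPlanes.
Variable R : realType.
Implicit Types (a k l d u v x y z : R) (chi : vfield R).

Lemma vf_apply_meridian_form chi u v :
  vf_apply chi (u *: X R + v *: Y R) = u%:MP * chi ix + v%:MP * chi iy.
Proof.
by rewrite vf_apply3 !(mderivD, mderivZ, mderivXU) /= !scaler0 !addr0 !add0r mulr0 addr0
  -!mul_mpolyC !mulr1 ![chi _ * _]mulrC.
Qed.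

Lemma vf_apply_parallel_form chi k : vf_apply chi (Z R - k%:MP) = chi iz.
Proof.
by rewrite vf_apply3 !(mderivB, mderivC, mderivXU) /= !subr0 !mulr0 !add0r mulr1.
Qed.

Definition pt3 x y z : 'rV[R]_3 := \row_i [:: x; y; z]`_i.

Lemma meval_pt3 x y z :
  ((X R).@[fun i => pt3 x y z ord0 i] = x) *
  ((Y R).@[fun i => pt3 x y z ord0 i] = y) *
  ((Z R).@[fun i => pt3 x y z ord0 i] = z).
Proof. by rewrite !mevalXU !mxE. Qed.

Lemma torus_pt3 a x y z :
  (x ^+ 2 + y ^+ 2 - a ^+ 2) ^+ 2 + z ^+ 2 = 1 -> torus a (pt3 x y z).
Proof.
rewrite !expr2 => h; rewrite /torus /zero_locus /torus_poly /=.
by rewrite !expr2 !(mevalD, mevalN, mevalM, mevalC, meval1, meval_pt3) h subrr.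
Qed.

(** Passes from infinitely many planes to infinitely many curves. The component through [p n] stays
    inside [H n], and [p n] lies in no other [H m], so distinct indices give distinct components. *)
Lemma infinite_curves a (S : set (set 'rV[R]_3)) (H : nat -> set 'rV[R]_3)
    (p : nat -> 'rV[R]_3) :
  (forall n, curves_in a (H n) `<=` S) -> (forall n, torus a (p n)) ->
  (forall n, H n (p n)) -> (forall m n, H m (p n) -> m = n) -> ~ finite_set S.
Proof.
move=> HS pT pH Hinj finS.
have HTp n : (H n `&` torus a) (p n) by split.
pose C n := connected_component (H n `&` torus a) (p n).
have Cinj : injective C.
  move=> m n Cmn; apply: Hinj.
  have : C n (p n) by apply: connected_component_refl.
  by rewrite -Cmn => /connected_component_sub[].
apply: infinite_nat; rewrite -(eq_finite_set (@inj_card_eq _ _ setT C (in2W Cinj))).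
by apply: sub_finite_set finS => _ [n _ <-]; apply: (HS n); exists (p n).
Qed.

Lemma finite_meridians_not_all a chi : 1 < a -> finite_set (invariant_meridians a chi) ->
  ~ (forall u v, invariant_surface chi (u *: X R + v *: Y R)).
Proof.
move=> a1 + hinv.
(* The plane [y = n x] meets the top circle [x^2 + y^2 = a^2], [z = 1] of the torus at
   [(c n, n c n, 1)]. As [c n] is nonzero, this point determines the slope. *)
pose c (n : nat) : R := a / Num.sqrt (1 + n%:R ^+ 2).
have s0 (n : nat) : 0 < 1 + n%:R ^+ 2 :> R by rewrite ltr_wpDr ?sqr_ge0.
have c0 n : c n != 0.
  by rewrite mulf_neq0 ?invr_neq0 ?sqrtr_eq0 -?ltNge // gt_eqF // (lt_trans ltr01).
apply: (@infinite_curves a _ (fun n => zero_locus (n%:R *: X R + (-1) *: Y R))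
  (fun n => pt3 (c n) (n%:R * c n) 1)).
- move=> n; apply: bigcup_sup; exists (n%:R *: X R + (-1) *: Y R) => //; split => //.
  by exists n%:R, (-1); split=> // -[_ /eqP]; rewrite oppr_eq0 oner_eq0.
- move=> n; apply: torus_pt3.
  have -> : c n ^+ 2 + (n%:R * c n) ^+ 2 = a ^+ 2.
    transitivity ((1 + n%:R ^+ 2) * c n ^+ 2); first by ring.
    by rewrite /c expr_div_n sqr_sqrtr ?ltW // mulrC divfK // gt_eqF.
  by rewrite subrr expr0n /= add0r expr1n.
- move=> n; rewrite /zero_locus /= !(mevalD, mevalZ, meval_pt3); ring.
- move=> m n; rewrite /zero_locus /= !(mevalD, mevalZ, meval_pt3) mulN1r => /eqP.
  by rewrite subr_eq0 => /eqP/(mulIf (c0 n))/eqP; rewrite eqr_nat => /eqP.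
Qed.

Lemma finite_parallels_not_all a chi : finite_set (invariant_parallels a chi) ->
  ~ (forall k, invariant_surface chi (Z R - k%:MP)).
Proof.
move=> + hinv.
(* Distinct heights in [[0, 1]]; solving the torus equation with [y = 0] and [z = k n] gives the
   points below. *)
pose k (n : nat) : R := n.+1%:R^-1.
have k01 n : 0 <= k n <= 1 by rewrite invr_ge0 ler0n invf_le1 ?ler1n.
apply: (@infinite_curves a _ (fun n => zero_locus (Z R - (k n)%:MP))
  (fun n => pt3 (Num.sqrt (a ^+ 2 + Num.sqrt (1 - k n ^+ 2))) 0 (k n))).
- move=> n; apply: bigcup_sup; exists (Z R - (k n)%:MP) => //; split => //.
  exists (k n); split=> //; have /andP[h0 ->] := k01 n.
  by rewrite andbT (le_trans _ h0) // oppr_le0.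
- move=> n; apply: torus_pt3.
  have /andP[h0 h1] := k01 n.
  rewrite sqr_sqrtr ?addr_ge0 ?sqr_ge0 ?sqrtr_ge0 // expr0n /= addr0 addrAC subrr add0r.
  rewrite sqr_sqrtr ?subrK // subr_ge0 expr_le1 //.
- by move=> n; rewrite /zero_locus /= mevalB mevalC meval_pt3 subrr.
- move=> m n; rewrite /zero_locus /= mevalB mevalC meval_pt3 => /eqP.
  by rewrite subr_eq0 => /eqP/invr_inj/eqP; rewrite eqr_nat => /eqP[].
Qed.

Lemma zero_locusZ (c : R) (g : poly3 R) : c != 0 -> zero_locus (c *: g) = zero_locus g.
Proof.
move=> c0; apply/seteqP; split=> v; rewrite /zero_locus /= mevalZ.
  by move/eqP; rewrite mulf_eq0 (negPf c0) => /eqP.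
by move=> ->; rewrite mulr0.
Qed.
End InvariantPlanes.

(** * Invariant planes of the normal form *)

Theorem theorem2p5 (R : realType) (a : R) (ha : 1 < a) (chi : vfield R)
    (hcubic : cubic chi) (hkol : kolmogorov chi)
    (htorus : vfield_on_torus a chi)
    (hmer : finite_set (invariant_meridians a chi))
    (hpar : finite_set (invariant_parallels a chi)) :
  invariant_meridian_planes chi = [set zero_locus (X R); zero_locus (Y R)] /\
  invariant_parallel_planes chi = [set zero_locus (Z R)].
Proof.
have hdeg : (vf_degree chi <= 3)%N by rewrite hcubic.
have [l [d [PE QE RE]]] := cubic_kolmogorov_normal_form ha hdeg hkol htorus.
have a0 : a != 0 by rewrite gt_eqF // (lt_trans ltr01).
have l0 : l != 0.
  apply/eqP => l0; apply: (finite_parallels_not_all hpar) => k; exists 0.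
  by rewrite vf_apply_parallel_form RE l0 mulr0 mpolyC0 !(mul0r, mulr0).
have d0 : d != 0.
  apply/eqP => d0; apply: (finite_meridians_not_all ha hmer) => u v.
  exists (l%:MP * Z R ^+ 2).
  rewrite vf_apply_meridian_form PE QE d0 mpolyC0 -!mul_mpolyC; ring.
split; apply/seteqP; split.
- move=> _ [_ [[u [v [uv0 ->]]] [L hL]] <-].
  rewrite vf_apply_meridian_form PE QE in hL.
  have : u * v = 0.
    (* The point [(v, -u, 0)] lies on the plane, so the cofactor side vanishes there and
       [d u v (u^2 + v^2) = 0] remains. *)
    move/(congr1 (meval (fun i => pt3 v (- u) 0 ord0 i))): hL.
    rewrite !expr2 !(mevalD, mevalN, mevalM, mevalC, mevalZ, meval_pt3) => hL.
    have : d * ((u * v) * (u ^+ 2 + v ^+ 2)) = 0.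
      have -> : d * ((u * v) * (u ^+ 2 + v ^+ 2)) = u * (v * (l * (0 * 0) + d * (- u * - u)))
        + v * (- u * (l * (0 * 0) - d * (v * v))) by ring.
      by rewrite hL; ring.
    move/eqP; rewrite !mulf_eq0 (negPf d0) /= => /orP[/orP[]/eqP->|]; rewrite ?mul0r ?mulr0 //.
    rewrite paddr_eq0 ?sqr_ge0 // => /andP[].
    by rewrite sqrf_eq0 => /eqP->; rewrite mul0r.
  move/eqP; rewrite mulf_eq0 => /orP[] /eqP w0; rewrite w0 scale0r ?add0r ?addr0.
    right; rewrite zero_locusZ //; apply/eqP => v0; apply: uv0; by rewrite w0 v0.
  left; rewrite zero_locusZ //; apply/eqP => v0; apply: uv0; by rewrite w0 v0.
- have inv1 u v : (u, v) <> (0, 0) -> u * v = 0 ->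
    invariant_meridian_planes chi (zero_locus (u *: X R + v *: Y R)).
    move=> uv0 uv; exists (u *: X R + v *: Y R) => //; split; first by exists u, v.
    (* The cofactor is [P / x] for the plane [x = 0] (case [v = 0]) and [Q / y] for [y = 0]. *)
    exists (l%:MP * Z R ^+ 2 + (if v == 0 then d%:MP * Y R ^+ 2 else - d%:MP * X R ^+ 2)).
    rewrite vf_apply_meridian_form PE QE -!mul_mpolyC.
    case: eqP uv => [-> _|/eqP v0 /eqP]; first by rewrite mpolyC0; ring.
    by rewrite mulf_eq0 (negPf v0) orbF => /eqP->; rewrite mpolyC0; ring.
  move=> _ [] ->.
    have := inv1 1 0; rewrite scale1r scale0r addr0; apply; last by rewrite mulr0.
    by move=> [/eqP]; rewrite oner_eq0.
  have := inv1 0 1; rewrite scale1r scale0r add0r; apply; last by rewrite mul0r.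
  by move=> [/eqP]; rewrite oner_eq0.
- move=> _ [_ [[k [_ ->]] [L hL]] <-].
  rewrite vf_apply_parallel_form RE in hL.
  (* On the plane [z = k] the third component must vanish; its values at [(0, 0, k)] and [(1, 0, k)]
     differ by [2 k l a^2]. *)
  have e x := congr1 (meval (fun i => pt3 x 0 k ord0 i)) hL.
  have := e 1; have := e 0.
  rewrite !expr2 !(mevalD, mevalN, mevalM, mevalC, meval_pt3) => e0 e1.
  have : k * l * a ^+ 2 = 0 by lra.
  by move/eqP; rewrite !mulf_eq0 (negPf l0) ?sqrf_eq0 (negPf a0) !orbF => /eqP->;
    rewrite mpolyC0 subr0.
- move=> _ ->; exists (Z R - 0%:MP); last by rewrite mpolyC0 subr0.
  split; first by exists 0; rewrite lerN10 ler01.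
  rewrite /invariant_surface vf_apply_parallel_form RE mpolyC0 subr0.
  by eexists; rewrite mulrC.
Qed.
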